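(* Consider the two-player zero-sum stochastic differential game driven by the controlled Markov regime-switching jump-diffusion $Y=Y^{u_1,u_2}$ described in the context. Let $\Delta=\{\lambda:\Omega\to\mathbb{R}\mid \lambda \text{ is } \mathcal{F}_T\text{-measurable and } E[\lambda]<\infty\}$ and $\Delta_1\subset\Delta$. Suppose that for all $\lambda\in\Delta_1$ we can find $\phi^{\lambda}(y,e_i)$, $i=1,\dots,D$, and a saddle point $(u_1^{*,\lambda},u_2^{*,\lambda})$ solving the unconstrained problem $$\phi^\lambda(y,e_i)=\sup_{u_1\in\Theta_1}\Big(\inf_{u_2\in\Theta_2}J^\lambda(y,e_i,u_1,u_2)\Big)=\inf_{u_2\in\Theta_2}\Big(\sup_{u_1\in\Theta_1}J^\lambda(y,e_i,u_1,u_2)\Big),\quad i=1,\dots,D,$$ subject to the state equation, where $$J^{\lambda}(y,e_i,u_1,u_2)=E^{y,e_i}\Big[\int_0^T f(t,Y(t),\alpha(t),u_1(t),u_2(t))\,dt+g(Y^{u_1,u_2}(T),\alpha(T))+\lambda\, M(Y^{u_1,u_2}(T),\alpha(T))\Big].$$ Moreover, suppose that there exists $\lambda_0\in\Delta_1$ such that $$M\big(Y^{u_1^{*,\lambda_0},u_2^{*,\lambda_0}}(T),e_i\big)=0\quad\text{a.s., for all } e_i\in S,\ i=1,\dots,D.$$ Then $\phi(y,e_i)=\phi^{\lambda_0}(y,e_i)$, $i=1,\dots,D$, and $(u_1^*,u_2^* )=(u_1^{*,\lambda_0},u_2^{*,\lambda_0})$ solves the constrained problem: to find $(u_1^*,u_2^*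 )$ for $$\phi(y,e_i)=\sup_{u_1\in\Theta_1}\Big(\inf_{u_2\in\Theta_2}J(y,e_i,u_1,u_2)\Big)=\inf_{u_2\in\Theta_2}\Big(\sup_{u_1\in\Theta_1}J(y,e_i,u_1,u_2)\Big),\quad i=1,\dots,D,$$ $$J(y,e_i,u_1,u_2)=E^{y,e_i}\Big[\int_0^T f(t,Y(t),\alpha(t),u_1(t),u_2(t))\,dt+g(Y^{u_1,u_2}(T),\alpha(T))\Big],$$ subject to the state equation and the constraint $M(Y^{u_1,u_2}(T),\alpha(T))=0$ a.s.
   Context: Probabilistic setting. $T>0$ is finite and $(\Omega,\mathbb{F},(\mathcal{F}_t)_{t\ge0},\mathbb{P})$ is a complete probability space whose right-continuous, $\mathbb{P}$-completed filtration is generated by mutually independent processes: an $M$-dimensional Brownian motion $W$ (this integer $M$ is unrelated to the constraint function $M$), an $L$-dimensional Poisson random measure $N=(N_1,\dots,N_L)$ on $[0,T]\times\mathbb{R}_0$, $\mathbb{R}_0=\mathbb{R}\setminus\{0\}$, and a continuous-time Markov chain $\alpha$ with state space $S=\{e_1,\dots,e_D\}$, the standard basis of $\mathbb{R}^D$, with transition intensities $\mu_{ij}(t)$ ($\mu_{ij}\ge0$ for $i\ne j$, $\sum_j\mu_{ij}=0$). $\tilde N_\alpha=(\tilde N_1,\dots,\tilde N_L)$ denotes the compensated Poisson random measures, $\tilde N_l(dt,dz)=N_l(dt,dz)-\nu^l_{\alpha(t-)}(dz)\,dt$, with Lévy measures $\nu^l_{e_i}$ depending on the regime. $\tilde\Phi=(\tilde\Phi_1,\dots,\tilde\Phi_D)^T$,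 where $\tilde\Phi_j(t)=\Phi_j(t)-\int_0^t\mu_j(s)\,ds$ is a martingale, $\Phi_j(t)$ is the number of jumps of $\alpha$ into $e_j$ up to time $t$, and $\mu_j(s)=\sum_{i\ne j}\mu_{ij}(s)\langle\alpha(s-),e_i\rangle$. State equation. For controls $u_1,u_2$, $$dY(t)=b(t,Y(t),\alpha(t),u_1(t),u_2(t))dt+\sigma(t,Y(t),\alpha(t),u_1(t),u_2(t))dW(t)$$ $$+\int_{\mathbb{R}_0}\eta(t,Y(t-),\alpha(t-),u_1(t-),u_2(t-),z)\tilde N_\alpha(dt,dz)+\gamma(t,Y(t-),\alpha(t-),u_1(t-),u_2(t-))d\tilde\Phi(t),$$ $Y(0)=y\in\mathbb{R}^N$, with measurable $b,\sigma,\eta,\gamma$ with values in $\mathbb{R}^N,\mathbb{R}^{N\times M},\mathbb{R}^{N\times L},\mathbb{R}^{N\times D}$ satisfying $\int_0^T\{|b|+|\sigma|^2+\int_{\mathbb{R}_0}|\eta|^2\nu(dz)+\sum_{j=1}^D|\gamma|^2\mu_j(t)\}dt<\infty$ along the solution. $E^{y,e_i}$ is expectation given $Y(0)=y$, $\alpha(0)=e_i$. Controls and data. $\mathcal{U}_1,\mathcal{U}_2\subset\mathbb{R}^N$ are non-empty. $\Theta_1,\Theta_2$ are given families of admissible controls: $u_k$ is $\mathcal{U}_k$-valued, $\mathcal{F}_t$-predictable, càdlàg, with $E[\int_0^T|u_k(t)|^2dt]<\infty$, the state equation has a unique strong solution, and $E[\int_0^T|f(t,Y(t),\alpha(t),u_1(t),u_2(t))|dt+|g(Y^{u_1,u_2}(T),\alpha(T))|]<\infty$.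 Here $f:[0,T]\times\mathbb{R}^N\times S\times\mathcal{U}_1\times\mathcal{U}_2\to\mathbb{R}$, $g:\mathbb{R}^N\times S\to\mathbb{R}$ and $M:\mathbb{R}^N\times S\to\mathbb{R}$ are $C^1$ in $y$, and it is assumed that $E[M(Y^{u_1,u_2}(T),\alpha(T))]<\infty$. Saddle point. $(u_1^*,u_2^* )\in\Theta_1\times\Theta_2$ is a saddle point for a functional $\mathcal J$ if $\mathcal J(y,e_i,u_1,u_2^* )\le \mathcal J(y,e_i,u_1^*,u_2^* )\le \mathcal J(y,e_i,u_1^*,u_2)$ for all $u_1\in\Theta_1$, $u_2\in\Theta_2$, $i=1,\dots,D$; the value of the game is then $\mathcal J(y,e_i,u_1^*,u_2^* )=\sup_{u_1\in\Theta_1}\inf_{u_2\in\Theta_2}\mathcal J=\inf_{u_2\in\Theta_2}\sup_{u_1\in\Theta_1}\mathcal J$.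
   Formalization: Over feasible pairs sup inf = inf sup can fail. Proved: (u1*,u2* ) is a saddle point against feasible deviations; the sup inf and inf sup have the outer player limited to controls compatible with the opponent's optimal control; without this limit, equality is given only if sup inf ≤ inf sup. *)

(* Defs.v *)
From mathcomp Require Export all_boot all_order all_algebra.
From mathcomp Require Export all_classical all_reals all_analysis.
From mathcomp Require Export measurable_realfun.

Set Implicit Arguments.
Unset Strict Implicit.
Unset Printing Implicit Defensive.

Export Order.TTheory GRing.Theory Num.Theory.
Export numFieldNormedType.Exports.

Local Open Scope classical_set_scope.
Local Open Scope ring_scope.

(* The regime e_i is the i-th standard basis row vector. *)
Definition basis_vec {R : realType} {D : nat} (i : 'I_D) : 'rV[R]_D :=
  delta_mx 0 i.

Definition regimes (R : realType) (D : nat) : set 'rV[R]_D :=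
  range (@basis_vec R D).
Arguments regimes : clear implicits.

Definition sqnorm {R : realType} {m n : nat} (A : 'M[R]_(m, n)) : R :=
  \sum_i \sum_j A i j ^+ 2.

Definition enorm {R : realType} {m n : nat} (A : 'M[R]_(m, n)) : R :=
  Num.sqrt (sqnorm A).

Definition C1 {R : realType} {n : nat} (h : 'rV[R]_n -> R) : Prop :=
  (forall y, differentiable h y) /\
  (forall v : 'rV[R]_n, continuous (fun y => 'D_v h y)).

Definition left_lim {R : realType} {n : nat} (x : R -> 'rV[R]_n) (t : R) :
    'rV[R]_n :=
  lim (x s @[s --> t^'-]).

Definition cadlag {R : realType} {n : nat} (T : R) (x : R -> 'rV[R]_n) : Prop :=
  (forall t, 0 <= t -> t < T -> x s @[s --> t^'+] --> x t) /\
  (forall t, 0 < t -> t <= T -> cvg (x s @[s --> t^'-])).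

Section sigma_algebras.
Context {R : realType}.

Definition preimages {X : Type} (H : set (X -> R)) : set (set X) :=
  [set A | exists2 h, H h & exists2 B : set R, measurable B & A = h @^-1` B].

(* h, defined on Dom only, is measurable for the trace on Dom of the
   sigma-algebra generated by the functions in H. *)
Definition measurable_on {X : Type} (H : set (X -> R)) (Dom : set X)
    (h : X -> R) : Prop :=
  forall B : set R, measurable B ->
    exists2 A, <<s preimages H >> A & Dom `&` h @^-1` B = Dom `&` A.

End sigma_algebras.

(* [mu t i j] is the intensity of the transitions i -> j at time t, [nu l e] the
   Levy measure of the l-th random measure in regime e, and [N l w] a measure on
   time x mark. *)
Record noise (R : realType) d (Omega : measurableType d) (m L D : nat) := Noise {
  W : 'I_m -> R -> Omega -> R ;
  N : 'I_L -> Omega -> {measure set (R * R)%type -> \bar R} ;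
  alpha : R -> Omega -> 'rV[R]_D ;
  mu : R -> 'M[R]_D ;
  nu : 'I_L -> 'rV[R]_D -> {measure set R -> \bar R} }.

Section noise_theory.
Context {R : realType} d {Omega : measurableType d} {m L D : nat}.
Variables (P : probability Omega R) (T : R) (Z : noise R Omega m L D).

Local Notation leb := (@lebesgue_measure R).
Local Notation W := (W Z).
Local Notation N := (N Z).
Local Notation alpha := (alpha Z).
Local Notation mu := (mu Z).
Local Notation nu := (nu Z).

Definition R0 : set R := [set z | z != 0].

Definition away_from_zero (A : set R) : Prop :=
  exists2 e : R, 0 < e & A `<=` [set z | e <= `|z|].

Definition alpha_left (t : R) (w : Omega) : 'rV[R]_D :=
  left_lim (alpha ^~ w) t.

Definition gen_W (s : R) : set (set Omega) :=
  preimages [set h | exists k r, 0 <= r <= s /\ h = W k r].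

Definition gen_alpha (s : R) : set (set Omega) :=
  preimages [set h | exists (i : 'I_D) r, 0 <= r <= s /\
                       h = (fun w => alpha r w 0 i)].

Definition gen_N (s : R) : set (set Omega) :=
  [set A | exists l (E : set (R * R)) (B : set (\bar R)),
     [/\ measurable E, E `<=` `[0, Num.min s T] `*` R0, measurable B &
         A = (fun w => N l w E) @^-1` B]].

Definition Filt (t : R) : set (set Omega) :=
  [set A | forall s, t < s ->
     <<s gen_W s `|` gen_N s `|` gen_alpha s `|` P.-negligible >> A].

Definition brownian : Prop :=
  [/\ forall k t, 0 <= t -> measurable_fun setT (W k t),
      forall k w, W k 0 w = 0,
      forall k w, {within `[0, +oo[, continuous (fun t => W k t w)} &
      forall (s t : R) (G : set Omega) (B : 'I_m -> set R),
        0 <= s -> s < t -> <<s gen_W s >> G -> (forall k, measurable (B k)) ->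
        P (G `&` [set w | forall k, B k (W k t w - W k s w)]) =
        (P G * \prod_(k < m) normal_prob 0 (Num.sqrt (t - s)) (B k))%E].

Definition intensity_matrix : Prop :=
  [/\ forall (t : R) i j, 0 <= t -> i != j -> 0 <= mu t i j,
      forall (t : R) i, 0 <= t -> \sum_j mu t i j = 0 &
      forall (t : R) i j, 0 <= t ->
        leb.-integrable `[0, t] (fun s => (mu s i j)%:E)].

(* Transition matrix [p s t] of the chain: Kolmogorov's forward equation,
   integrated because mu is only locally integrable. *)
Definition transition_function (p : R -> R -> 'M[R]_D) : Prop :=
  [/\ forall (s t : R) i j, 0 <= s -> s <= t -> 0 <= p s t i j,
      forall (s t : R) i, 0 <= s -> s <= t -> \sum_j p s t i j = 1,
      forall (s t : R) i j, 0 <= s -> s <= t ->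
        measurable_fun `[s, t] (fun r => p s r i j) &
      forall (s t : R) i j, 0 <= s -> s <= t ->
        p s t i j = (i == j)%:R +
          \int[leb]_(r in `[s, t]) (\sum_k p s r i k * mu r k j)].

Definition markov_chain : Prop :=
  [/\ forall (t : R) w, 0 <= t -> regimes R D (alpha t w),
      forall (t : R) i, 0 <= t -> measurable [set w | alpha t w = basis_vec i],
      forall (t' : R) w, cadlag t' (alpha ^~ w) &
      exists2 p, transition_function p &
        forall (s t : R) i j G, 0 <= s -> s <= t -> <<s gen_alpha s >> G ->
          P (G `&` [set w | alpha s w = basis_vec i]
               `&` [set w | alpha t w = basis_vec j]) =
          ((p s t i j)%:E * P (G `&` [set w | alpha s w = basis_vec i]))%E].

Definition levy_measures : Prop :=
  forall l e, regimes R D e ->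
    nu l e [set 0] = 0%E /\
    (\int[nu l e]_z (Num.min 1 (z ^+ 2))%:E < +oo)%E.

Definition cumulative_intensity (l : 'I_L) (E : set (R * R)) (w : Omega) : R :=
  fine (\int[leb]_(t in `[0%R, T]) nu l (alpha_left t w) (xsection E t))%E.

(* The library's poisson_pmf is not used because its value at rate 0 is not a
   probability mass function. *)
Definition poisson_weight (r : R) (k : nat) : R := r ^+ k / k`!%:R * expR (- r).

(* The intensity nu_{alpha(t-)}(dz)dt is random, so the N_l can be independent
   of alpha only up to this intensity: given (W, alpha), they are independent
   Poisson random measures with intensities nu^l_{alpha(t-)}(dz)dt.  If nu does
   not depend on the regime, this says that N_1, ..., N_L are independent
   Poisson random measures, independent of (W, alpha). *)
Definition poisson_random_measures : Prop :=
  [/\ forall l w, N l w (~` (`[0, T] `*` R0)) = 0%E,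
      forall l E, measurable E -> measurable_fun setT (fun w => N l w E),
      forall l w (E : set (R * R)), measurable E ->
        away_from_zero (snd @` E) -> exists c : nat, N l w E = c%:R%:E &
      forall (k : nat) (l : 'I_k -> 'I_L) (E : 'I_k -> set (R * R))
          (c : 'I_k -> nat) (s : R) (G : set Omega),
        (forall i, [/\ measurable (E i), E i `<=` `[0, T] `*` R0 &
                      away_from_zero (snd @` E i)]) ->
        (forall i j, i != j -> l i = l j -> E i `&` E j = set0) ->
        <<s gen_W s `|` gen_alpha s >> G ->
        P (G `&` [set w | forall i, N (l i) w (E i) = (c i)%:R%:E]) =
        (\int[P]_(w in G)
          (\prod_(i < k) poisson_weight
             (cumulative_intensity (l i) (E i) w) (c i))%:E)%E].

Definition independent_W_alpha : Prop :=
  forall s A B, <<s gen_W s >> A -> <<s gen_alpha s >> B ->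
    P (A `&` B) = (P A * P B)%E.

(* The last clause makes E^{y,e_i}, the expectation given alpha(0) = e_i,
   well defined for every i. *)
Definition noise_spec : Prop :=
  [/\ measure_is_complete P,
      [/\ brownian, intensity_matrix, markov_chain, levy_measures &
          poisson_random_measures],
      independent_W_alpha &
      forall i : 'I_D, (0 < P [set w | alpha 0 w = basis_vec i])%E].

Definition jumps_into (j : 'I_D) (t : R) (w : Omega) : R :=
  fine (counting [set s : R | [/\ 0 < s <= t, alpha s w = basis_vec j &
                                    alpha_left s w != basis_vec j]]).

Definition jump_rate (j : 'I_D) (s : R) (w : Omega) : R :=
  \sum_(i | i != j) mu s i j * alpha_left s w 0 i.

Definition Phi_tilde (j : 'I_D) (t : R) (w : Omega) : R :=
  jumps_into j t w - \int[leb]_(s in `[0%R, t]) jump_rate j s w.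

(* N~_l(]a, b] x A), for A away from zero. *)
Definition N_tilde (l : 'I_L) (a b : R) (A : set R) (w : Omega) : R :=
  fine (N l w (`]a, b] `*` A)) -
  \int[leb]_(s in `]a, b]) fine (nu l (alpha_left s w) A).

Definition adapted {n : nat} (x : R -> Omega -> 'rV[R]_n) : Prop :=
  forall t k (B : set R), 0 <= t <= T -> measurable B ->
    Filt t [set w | B (x t w 0 k)].

Definition predictable_sets : set (set (R * Omega)) :=
  <<s [set C | (exists2 A, Filt 0 A & C = [set 0] `*` A) \/
               (exists a b A, [/\ 0 <= a, a <= b, b <= T, Filt a A &
                                  C = `]a, b] `*` A])] >>.

Definition predictable {n : nat} (x : R -> Omega -> 'rV[R]_n) : Prop :=
  forall k (B : set R), measurable B ->
    predictable_sets [set q | 0 <= q.1 <= T /\ B (x q.1 q.2 0 k)].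

End noise_theory.

(* Stochastic integrals are limits in probability of integrals of elementary
   integrands sum_k xi_k 1_{]a_k, b_k]}(t) 1_{A_k}(z), the integrands converging
   in probability for a random quadratic form [energy].  Marks z live in [K]:
   K = R for N~_l; K = unit for the Brownian motions and for Phi~_j. *)
Section stochastic_integral.
Context {R : realType} d {Omega : measurableType d} {K : Type}.
Variable P : probability Omega R.

Record elementary := Elementary {
  el_n : nat ;
  el_a : 'I_el_n -> R ;
  el_b : 'I_el_n -> R ;
  el_A : 'I_el_n -> set K ;
  el_xi : 'I_el_n -> Omega -> R }.

Definition elementary_spec (F : R -> set (set Omega)) (T : R)
    (marks : set (set K)) (h : elementary) : Prop :=
  forall k : 'I_(el_n h),
    [/\ 0 <= el_a k, el_a k <= el_b k & el_b k <= T] /\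
    [/\ marks (el_A k),
        forall B : set R, measurable B -> F (el_a k) (el_xi k @^-1` B) &
        exists C : R, forall w, `|el_xi k w| <= C].

Definition el_fun (h : elementary) (s : R) (z : K) (w : Omega) : R :=
  \sum_k el_xi k w * \1_(`]el_a k, el_b k]) s * \1_(el_A (e := h) k) z.

(* [X a b A] is the increment of the integrator over ]a, b] x A. *)
Definition el_integral (X : R -> R -> set K -> Omega -> R) (h : elementary)
    (t : R) (w : Omega) : R :=
  \sum_k el_xi k w *
    X (Num.min (el_a k) t) (Num.min (el_b k) t) (el_A (e := h) k) w.

(* Stated with measurable supersets, so that no measurability of x has to be
   known beforehand. *)
Definition cvg0_in_probability (x : nat -> Omega -> \bar R) : Prop :=
  forall e delta : R, 0 < e -> 0 < delta ->
    \forall n \near \oo, exists B : set Omega,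
      [/\ measurable B, [set w | (e%:E <= x n w)%E] `<=` B &
          (P B <= delta%:E)%E].

Definition is_stochastic_integral (F : R -> set (set Omega)) (T : R)
    (marks : set (set K)) (X : R -> R -> set K -> Omega -> R)
    (energy : R -> (R -> K -> R) -> Omega -> \bar R)
    (H : R -> K -> Omega -> R) (t : R) (I : Omega -> R) : Prop :=
  exists h : nat -> elementary,
    [/\ forall n, elementary_spec F T marks (h n),
        cvg0_in_probability (fun n w =>
          energy t (fun s z => el_fun (h n) s z w - H s z w) w) &
        cvg0_in_probability (fun n w =>
          `|el_integral X (h n) t w - I w|%:E)].

End stochastic_integral.

Arguments elementary R {d} Omega K.

Record game_data (R : realType) (n m L D : nat) := GameData {
  b : R -> 'rV[R]_n -> 'rV[R]_D -> 'rV[R]_n -> 'rV[R]_n -> 'rV[R]_n ;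
  sigma : R -> 'rV[R]_n -> 'rV[R]_D -> 'rV[R]_n -> 'rV[R]_n -> 'M[R]_(n, m) ;
  eta : R -> 'rV[R]_n -> 'rV[R]_D -> 'rV[R]_n -> 'rV[R]_n -> R -> 'M[R]_(n, L) ;
  gamma : R -> 'rV[R]_n -> 'rV[R]_D -> 'rV[R]_n -> 'rV[R]_n -> 'M[R]_(n, D) ;
  f : R -> 'rV[R]_n -> 'rV[R]_D -> 'rV[R]_n -> 'rV[R]_n -> R ;
  g : 'rV[R]_n -> 'rV[R]_D -> R ;
  constraint_fun : 'rV[R]_n -> 'rV[R]_D -> R ;
  U1 : set 'rV[R]_n ;
  U2 : set 'rV[R]_n }.

Definition process (R : realType) d (Omega : measurableType d) (n : nat) :=
  R -> Omega -> 'rV[R]_n.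

Section game.
Context {R : realType} d {Omega : measurableType d} {n m L D : nat}.
Variables (P : probability Omega R) (T : R) (Z : noise R Omega m L D).
Variable G : game_data R n m L D.

Local Notation leb := (@lebesgue_measure R).
Local Notation process := (process R Omega n).
Local Notation W := (W Z).
Local Notation alpha := (alpha Z).
Local Notation nu := (nu Z).
Local Notation Filt := (Filt P T Z).

Definition point := (R * 'rV[R]_n * 'rV[R]_D * 'rV[R]_n * 'rV[R]_n)%type.

Definition point_domain : set point :=
  [set q | [/\ 0 <= q.1.1.1.1 <= T, regimes R D q.1.1.2, U1 G q.1.2 &
               U2 G q.2]].

Definition point_coords : set (point -> R) :=
  [set (fun q : point => q.1.1.1.1)] `|`
  range (fun (k : 'I_n) (q : point) => q.1.1.1.2 0 k) `|`
  range (fun (k : 'I_D) (q : point) => q.1.1.2 0 k) `|`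
  range (fun (k : 'I_n) (q : point) => q.1.2 0 k) `|`
  range (fun (k : 'I_n) (q : point) => q.2 0 k).

Definition at_point {V : Type}
    (h : R -> 'rV[R]_n -> 'rV[R]_D -> 'rV[R]_n -> 'rV[R]_n -> V) (q : point) : V :=
  h q.1.1.1.1 q.1.1.1.2 q.1.1.2 q.1.2 q.2.

Definition game_spec : Prop :=
  [/\ U1 G !=set0 /\ U2 G !=set0,
      [/\ forall k, measurable_on point_coords point_domain
            (fun q => at_point (b G) q 0 k),
          forall k j, measurable_on point_coords point_domain
            (fun q => at_point (sigma G) q k j),
          forall k j, measurable_on
            ([set h \o fst | h in point_coords] `|` [set snd])
            (point_domain `*` R0)
            (fun q => at_point (eta G) q.1 q.2 k j) &
          forall k j, measurable_on point_coords point_domain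
            (fun q => at_point (gamma G) q k j)],
      forall t e v1 v2, 0 <= t <= T -> regimes R D e -> U1 G v1 -> U2 G v2 ->
        C1 (fun y => f G t y e v1 v2) &
      forall e, regimes R D e ->
        C1 (fun y => g G y e) /\ C1 (fun y => constraint_fun G y e)].

Definition along {V : Type}
    (h : R -> 'rV[R]_n -> 'rV[R]_D -> 'rV[R]_n -> 'rV[R]_n -> V)
    (Y u1 u2 : process) (t : R) (w : Omega) : V :=
  h t (Y t w) (alpha t w) (u1 t w) (u2 t w).

Definition along_left {V : Type}
    (h : R -> 'rV[R]_n -> 'rV[R]_D -> 'rV[R]_n -> 'rV[R]_n -> V)
    (Y u1 u2 : process) (t : R) (w : Omega) : V :=
  h t (left_lim (Y ^~ w) t) (alpha_left Z t w)
    (left_lim (u1 ^~ w) t) (left_lim (u2 ^~ w) t).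

Definition coefficients_integrable (Y u1 u2 : process) : Prop :=
  {ae P, forall w, (\int[leb]_(t in `[0%R, T])
    ((enorm (along (b G) Y u1 u2 t w))%:E +
     (sqnorm (along (sigma G) Y u1 u2 t w))%:E +
     \sum_(l < L) \int[nu l (alpha_left Z t w)]_(z in R0)
        (sqnorm (col l (along_left (eta G) Y u1 u2 t w z)))%:E +
     \sum_(j < D) (sqnorm (col j (along_left (gamma G) Y u1 u2 t w)) *
                   jump_rate Z j t w)%:E) < +oo)%E}.

Definition is_integral_dW (k : 'I_m) (H : R -> Omega -> R) (t : R)
    (I : Omega -> R) : Prop :=
  is_stochastic_integral P Filt T [set [set: unit]]
    (fun a b _ w => W k b w - W k a w)
    (fun t h w => \int[leb]_(s in `[0%R, t]) (h s tt ^+ 2)%:E)%E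
    (fun s _ w => H s w) t I.

Definition is_integral_dN (l : 'I_L) (H : R -> R -> Omega -> R) (t : R)
    (I : Omega -> R) : Prop :=
  is_stochastic_integral P Filt T
    [set A | [/\ measurable A, A `<=` R0 & away_from_zero A]]
    (N_tilde Z l)
    (fun t h w => \int[leb]_(s in `[0%R, t])
        \int[nu l (alpha_left Z s w)]_(z in R0) (h s z ^+ 2)%:E)%E
    H t I.

Definition is_integral_dPhi (j : 'I_D) (H : R -> Omega -> R) (t : R)
    (I : Omega -> R) : Prop :=
  is_stochastic_integral P Filt T [set [set: unit]]
    (fun a b _ w => Phi_tilde Z j b w - Phi_tilde Z j a w)
    (fun t h w => \int[leb]_(s in `[0%R, t])
        (h s tt ^+ 2 * jump_rate Z j s w)%:E)%E
    (fun s _ w => H s w) t I.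

Definition state_equation (y : 'rV[R]_n) (u1 u2 Y : process) : Prop :=
  {ae P, forall w, Y 0 w = y} /\
  forall (t : R) (k : 'I_n), 0 <= t <= T ->
    exists (IW : 'I_m -> Omega -> R) (IN : 'I_L -> Omega -> R)
           (IPhi : 'I_D -> Omega -> R),
      [/\ forall j, is_integral_dW j
            (fun s w => along (sigma G) Y u1 u2 s w k j) t (IW j),
          forall l, is_integral_dN l
            (fun s z w => along_left (eta G) Y u1 u2 s w z k l) t (IN l),
          forall j, is_integral_dPhi j
            (fun s w => along_left (gamma G) Y u1 u2 s w k j) t (IPhi j) &
          {ae P, forall w, Y t w 0 k =
             y 0 k + \int[leb]_(s in `[0%R, t]) along (b G) Y u1 u2 s w 0 k +
             \sum_j IW j w + \sum_l IN l w + \sum_j IPhi j w}].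

Definition strong_solution (y : 'rV[R]_n) (u1 u2 Y : process) : Prop :=
  [/\ adapted P T Z Y, forall w, cadlag T (Y ^~ w),
      coefficients_integrable Y u1 u2 & state_equation y u1 u2 Y].

Definition unique_strong_solution (y : 'rV[R]_n) (u1 u2 Y : process) : Prop :=
  strong_solution y u1 u2 Y /\
  forall Y', strong_solution y u1 u2 Y' ->
    {ae P, forall w, forall t, 0 <= t <= T -> Y' t w = Y t w}.

Definition control (U : set 'rV[R]_n) (u : process) : Prop :=
  [/\ forall (t : R) w, 0 <= t <= T -> U (u t w),
      predictable P T Z u, forall w, cadlag T (u ^~ w) &
      (\int[P]_w \int[leb]_(t in `[0%R, T]) (sqnorm (u t w))%:E < +oo)%E].

Definition expectation_lt_pinfty (X : Omega -> R) : Prop :=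
  (\int[P]_w (Num.max (X w) 0)%:E < +oo)%E.

(* E[int_0^T |f| dt + |g|] < oo is integrability of f for dt x dP and of g
   for dP. *)
Definition payoff_integrable (u1 u2 Y : process) : Prop :=
  (leb \x P)%E.-integrable (`[0, T] `*` setT)
    (fun q => (along (f G) Y u1 u2 q.1 q.2)%:E) /\
  P.-integrable setT (fun w => (g G (Y T w) (alpha T w))%:E).

(* [Y u1 u2] is the solution of the state equation started at y. *)
Definition admissible (y : 'rV[R]_n) (Theta1 Theta2 : set process)
    (Y : process -> process -> process) : Prop :=
  [/\ Theta1 `<=` control (U1 G), Theta2 `<=` control (U2 G) &
      forall u1 u2, Theta1 u1 -> Theta2 u2 ->
        [/\ unique_strong_solution y u1 u2 (Y u1 u2),
            payoff_integrable u1 u2 (Y u1 u2),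
            measurable_fun setT
              (fun w => constraint_fun G (Y u1 u2 T w) (alpha T w)) &
            expectation_lt_pinfty
              (fun w => constraint_fun G (Y u1 u2 T w) (alpha T w))]].

(* E^{y,e_i}; Y(0) = y is deterministic. *)
Definition expectation_from (i : 'I_D) (X : Omega -> R) : \bar R :=
  ((fine (P [set w | alpha 0%R w = basis_vec i]))^-1%:E *
   \int[P]_(w in [set w | alpha 0%R w = basis_vec i]) (X w)%:E)%E.

Variable Y : process -> process -> process.

Definition J (i : 'I_D) (u1 u2 : process) : \bar R :=
  expectation_from i (fun w =>
    \int[leb]_(t in `[0%R, T]) along (f G) (Y u1 u2) u1 u2 t w +
    g G (Y u1 u2 T w) (alpha T w)).

Definition Jlambda (lam : Omega -> R) (i : 'I_D) (u1 u2 : process) : \bar R :=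
  expectation_from i (fun w =>
    \int[leb]_(t in `[0%R, T]) along (f G) (Y u1 u2) u1 u2 t w +
    g G (Y u1 u2 T w) (alpha T w) +
    lam w * constraint_fun G (Y u1 u2 T w) (alpha T w)).

Definition Delta : set (Omega -> R) :=
  [set lam | (forall B : set R, measurable B -> Filt T (lam @^-1` B)) /\
             expectation_lt_pinfty lam].

Definition feasible (u1 u2 : process) : Prop :=
  {ae P, forall w, constraint_fun G (Y u1 u2 T w) (alpha T w) = 0}.

End game.

Section zero_sum.
Context {R : realType} {C : Type} {D : nat}.
Implicit Types (Jf : 'I_D -> C -> C -> \bar R) (phi : 'I_D -> R).

(* Each player's choices may depend on the control already chosen by the
   other one. *)
Definition sup_inf (A1 : set C) (A2 : C -> set C) (Ji : C -> C -> \bar R) :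
    \bar R :=
  ereal_sup [set ereal_inf [set Ji u1 u2 | u2 in A2 u1] | u1 in A1].

Definition inf_sup (A1 : C -> set C) (A2 : set C) (Ji : C -> C -> \bar R) :
    \bar R :=
  ereal_inf [set ereal_sup [set Ji u1 u2 | u1 in A1 u2] | u2 in A2].

Definition saddle_point (Theta1 Theta2 : set C) Jf (u1s u2s : C) : Prop :=
  [/\ Theta1 u1s, Theta2 u2s &
      forall i u1 u2, Theta1 u1 -> Theta2 u2 ->
        (Jf i u1 u2s <= Jf i u1s u2s)%E /\ (Jf i u1s u2s <= Jf i u1s u2)%E].

Definition solves_unconstrained (Theta1 Theta2 : set C) Jf phi (u1s u2s : C) :
    Prop :=
  saddle_point Theta1 Theta2 Jf u1s u2s /\
  forall i, (phi i)%:E = sup_inf Theta1 (fun=> Theta2) (Jf i) /\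
            (phi i)%:E = inf_sup (fun=> Theta1) Theta2 (Jf i).

(* Saddle point and value over the pairs of controls satisfying the constraint
   [feas].  As feas couples the two players, the deviations from (u1s, u2s) are
   those that satisfy it against the other component, and in sup inf (inf sup)
   every evaluated pair satisfies it, the outer player choosing among the
   controls compatible with u2s (u1s).  When feas holds exactly on a rectangle
   B1 x B2, these are the sup inf and inf sup over B1 and B2. *)
Definition solves_constrained (Theta1 Theta2 : set C) (feas : C -> C -> Prop)
    Jf phi (u1s u2s : C) : Prop :=
  [/\ Theta1 u1s, Theta2 u2s, feas u1s u2s,
      (forall i u1, Theta1 u1 -> feas u1 u2s ->
         (Jf i u1 u2s <= Jf i u1s u2s)%E) /\
      (forall i u2, Theta2 u2 -> feas u1s u2 ->
         (Jf i u1s u2s <= Jf i u1s u2)%E) &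
      forall i,
        [/\ (phi i)%:E = Jf i u1s u2s,
            (phi i)%:E = sup_inf (Theta1 `&` [set u1 | feas u1 u2s])
                           (fun u1 => Theta2 `&` [set u2 | feas u1 u2]) (Jf i) &
            (phi i)%:E = inf_sup
                           (fun u2 => Theta1 `&` [set u1 | feas u1 u2])
                           (Theta2 `&` [set u2 | feas u1s u2]) (Jf i)]].

(* Outer player unrestricted: every control that some control of the other
   player makes feasible.  Here sup inf <= inf sup may fail. *)
Definition coupled_sup_inf (Theta1 Theta2 : set C) (feas : C -> C -> Prop)
    (Ji : C -> C -> \bar R) : \bar R :=
  sup_inf [set u1 | Theta1 u1 /\ exists2 u2, Theta2 u2 & feas u1 u2]
    (fun u1 => Theta2 `&` [set u2 | feas u1 u2]) Ji.

Definition coupled_inf_sup (Theta1 Theta2 : set C) (feas : C -> C -> Prop)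
    (Ji : C -> C -> \bar R) : \bar R :=
  inf_sup (fun u2 => Theta1 `&` [set u1 | feas u1 u2])
    [set u2 | Theta2 u2 /\ exists2 u1, Theta1 u1 & feas u1 u2] Ji.

End zero_sum.

(* Main.v *)
(* On every pair of controls satisfying the constraint, the multiplier term
   lambda M vanishes almost surely, so J and J^lambda agree there for every
   lambda.  The saddle point for lambda_0 is itself feasible, and its saddle
   inequalities for J^lambda_0, restricted to the feasible one-sided deviations,
   are inequalities for J; they pin down the constrained value. *)
Require Import Defs.

Set Implicit Arguments.
Unset Strict Implicit.
Unset Printing Implicit Defensive.

Local Open Scope classical_set_scope.
Local Open Scope ring_scope.

Section saddle_value.
Context {R : realType} {C : Type}.
Variables (A1 : set C) (A2 : C -> set C) (Ji : C -> C -> \bar R) (u1s u2s : C).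
Local Open Scope ereal_scope.

(** [u1s] is an allowed outer choice, so its inner infimum is one of the competitors in the
    supremum. *)
Lemma sup_inf_ge : A1 u1s -> (forall u2, A2 u1s u2 -> Ji u1s u2s <= Ji u1s u2) ->
  Ji u1s u2s <= sup_inf A1 A2 Ji.
Proof.
move=> h1 h2; apply: (@le_trans _ _ (ereal_inf [set Ji u1s u2 | u2 in A2 u1s])).
  by apply: le_ereal_inf_tmp => _ [u2 u2A <-]; exact: h2.
by apply: ereal_sup_ubound; exists u1s.
Qed.

(** [u2s] must be a legal answer to every outer choice. This is why the constrained outer sets keep
    only controls compatible with the other player's optimal one. *)
Lemma sup_inf_le :
    (forall u1, A1 u1 -> A2 u1 u2s /\ Ji u1 u2s <= Ji u1s u2s) ->
  sup_inf A1 A2 Ji <= Ji u1s u2s.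
Proof.
move=> h; apply: ge_ereal_sup => _ [u1 /h[u2A le1] <-].
by apply: le_trans le1; apply: ereal_inf_lbound; exists u2s.
Qed.

End saddle_value.

Section saddle_value_dual.
Context {R : realType} {C : Type}.
Variables (A1 : C -> set C) (A2 : set C) (Ji : C -> C -> \bar R) (u1s u2s : C).
Local Open Scope ereal_scope.

Lemma inf_sup_le : A2 u2s -> (forall u1, A1 u2s u1 -> Ji u1 u2s <= Ji u1s u2s) ->
  inf_sup A1 A2 Ji <= Ji u1s u2s.
Proof.
move=> h1 h2; apply: (@le_trans _ _ (ereal_sup [set Ji u1 u2s | u1 in A1 u2s])).
  by apply: ereal_inf_lbound; exists u2s.
by apply: ge_ereal_sup => _ [u1 u1A <-]; exact: h2.
Qed.

Lemma inf_sup_ge :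
    (forall u2, A2 u2 -> A1 u2 u1s /\ Ji u1s u2s <= Ji u1s u2) ->
  Ji u1s u2s <= inf_sup A1 A2 Ji.
Proof.
move=> h; apply: le_ereal_inf_tmp => _ [u2 /h[u1A le1] <-].
by apply: (le_trans le1); apply: ereal_sup_ubound; exists u1s.
Qed.

End saddle_value_dual.

(** [phi] is given only as a sup inf. With a constant inner set [u2s] answers every [u1], so both
    bounds above meet at the saddle point. *)
Lemma saddle_point_value {R : realType} {C : Type} {D : nat}
    (Theta1 Theta2 : set C) (Jf : 'I_D -> C -> C -> \bar R) (phi : 'I_D -> R)
    (u1s u2s : C) i :
  solves_unconstrained Theta1 Theta2 Jf phi u1s u2s ->
  (phi i)%:E = Jf i u1s u2s.
Proof.
move=> [[h1 h2 sp] /(_ i)[-> _]]; apply/eqP; rewrite eq_le.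
rewrite sup_inf_le ?sup_inf_ge// => [u2 hu2|u1 hu1].
  by have [] := sp i _ _ h1 hu2.
by split=> //; have [] := sp i _ _ hu1 h2.
Qed.

Section agreement_on_feasible_pairs.
Context {R : realType} {C : Type} {D : nat}.
Variables (Theta1 Theta2 : set C) (feas : C -> C -> Prop).
Variables (Jl Jf : 'I_D -> C -> C -> \bar R) (phi : 'I_D -> R) (u1s u2s : C).
Hypothesis JlE : forall i u1 u2, Theta1 u1 -> Theta2 u2 -> feas u1 u2 ->
  Jl i u1 u2 = Jf i u1 u2.
Hypothesis sol : solves_unconstrained Theta1 Theta2 Jl phi u1s u2s.
Hypothesis feas_star : feas u1s u2s.

Let Theta1s : Theta1 u1s. Proof. by have [[]] := sol. Qed.
Let Theta2s : Theta2 u2s. Proof. by have [[]] := sol. Qed.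

Let value i : (phi i)%:E = Jf i u1s u2s.
Proof. by rewrite (saddle_point_value i sol) JlE. Qed.

Let le_star i u1 : Theta1 u1 -> feas u1 u2s -> (Jf i u1 u2s <= Jf i u1s u2s)%E.
Proof.
(* Both pairs compared are feasible, so the inequality may be read for [Jl]. *)
move=> h1 hf; rewrite -!JlE//; have [[_ _ sp] _] := sol.
by have [] := sp i _ _ h1 Theta2s.
Qed.

Let ge_star i u2 : Theta2 u2 -> feas u1s u2 -> (Jf i u1s u2s <= Jf i u1s u2)%E.
Proof.
move=> h2 hf; rewrite -!JlE//; have [[_ _ sp] _] := sol.
by have [] := sp i _ _ Theta1s h2.
Qed.

Lemma solves_constrained_of_agree :
  solves_constrained Theta1 Theta2 feas Jf phi u1s u2s.
Proof.
(* Each value equation splits into two bounds. Membership in an outer set contains exactly the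
   compatibility that makes the saddle control a legal answer. *)
split=> // i; rewrite value; split=> //; apply/eqP; rewrite eq_le; apply/andP; split.
- by apply: sup_inf_ge => // u2 [? ?]; exact: ge_star.
- by apply: sup_inf_le => u1 [? ?]; split=> //; exact: le_star.
- by apply: inf_sup_ge => u2 [? ?]; split=> //; exact: ge_star.
- by apply: inf_sup_le => // u1 [? ?]; exact: le_star.
Qed.

(** With an unrestricted outer player [u2s] may be an illegal answer, so only inf sup <=
    [Jf i u1s u2s] <= sup inf survives. The assumed inequality closes this chain into equalities. *)
Lemma coupled_value_of_agree i :
  (coupled_sup_inf Theta1 Theta2 feas (Jf i) <=
   coupled_inf_sup Theta1 Theta2 feas (Jf i))%E ->
  (phi i)%:E = coupled_sup_inf Theta1 Theta2 feas (Jf i) /\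
  (phi i)%:E = coupled_inf_sup Theta1 Theta2 feas (Jf i).
Proof.
rewrite value => le_si.
have ge : (Jf i u1s u2s <= coupled_sup_inf Theta1 Theta2 feas (Jf i))%E.
  apply: sup_inf_ge => [|u2 [? ?]]; last exact: ge_star.
  by split=> //; exists u2s.
have le : (coupled_inf_sup Theta1 Theta2 feas (Jf i) <= Jf i u1s u2s)%E.
  apply: inf_sup_le => [|u1 [? ?]]; last exact: le_star.
  by split=> //; exists u1s.
split; apply/eqP; rewrite eq_le.
  by rewrite ge (le_trans le_si le).
by rewrite (le_trans ge le_si) le.
Qed.

End agreement_on_feasible_pairs.

Section multiplier.
Context {R : realType} {d : measure_display} {Omega : measurableType d}.
Context {n m L D : nat}.
Variables (P : probability Omega R) (T : R) (Z : noise R Omega m L D).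
Variable G : game_data R n m L D.

(** Fubini: joint integrability in (t, w) makes the time integral measurable in w. *)
Lemma measurable_payoff (u1 u2 Y : process R Omega n) :
  payoff_integrable P T Z G u1 u2 Y ->
  measurable_fun setT (fun w =>
    \int[@lebesgue_measure R]_(t in `[0, T]) along Z (f G) Y u1 u2 t w +
    g G (Y T w) (alpha Z T w)).
Proof.
move=> [intf intg]; apply: measurable_funD; last first.
  by apply/measurable_EFinP; exact: measurable_int intg.
apply: (measurableT_comp (fine_measurable measurableT)).
have mD : measurable (`[0, T] `*` setT : set (measurableTypeR R * Omega)).
  exact: measurableX.
(* The integrand is extended by zero off the strip, since Fubini is applied on the whole product
   space. *)
have := measurable_fubini_G ((integrable_mkcond _ mD).1 intf).
apply: eq_measurable_fun => w _; rewrite /fubini_G [RHS]integral_mkcond.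
apply: eq_integral => t _; rewrite /patch.
by have -> : ((t, w) \in `[0, T] `*` [set: Omega]) = (t \in `[0, T]%classic)
  by rewrite in_setX in_setT andbT.
Qed.

(** Measurability is asked of [X] only: the integrand carrying an arbitrary multiplier comes with
    none of its own. *)
Lemma expectation_from_ae_eq (i : 'I_D) (X X' : Omega -> R) :
  measure_is_complete P ->
  measurable [set w | alpha Z 0 w = basis_vec i] ->
  measurable_fun setT X -> {ae P, forall w, X w = X' w} ->
  expectation_from P Z i X = expectation_from P Z i X'.
Proof.
move=> Pc mA mX XX'; congr (_ * _)%E.
have mEX : measurable_fun setT (EFin \o X) by exact/measurable_EFinP.
have mEX' : measurable_fun setT (EFin \o X').
  (* Completeness of P is what makes X' measurable. *)
  apply: (ae_measurable_fun Pc _ mEX).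
  by apply: filterS XX' => w /= -> _.
apply: ae_eq_integral => //.
- exact: measurable_funTS mEX.
- exact: measurable_funTS mEX'.
- by apply: filterS XX' => w /= -> _.
Qed.

Variables (y : 'rV[R]_n) (Theta1 Theta2 : set (process R Omega n)).
Variable Y : process R Omega n -> process R Omega n -> process R Omega n.

(** The integrands agree almost surely because [lam w] is a finite real, so no integrability of the
    product with the constraint is involved. *)
Lemma Jlambda_feasible (lam : Omega -> R) (i : 'I_D) u1 u2 :
  noise_spec P T Z -> admissible P T Z G y Theta1 Theta2 Y ->
  Theta1 u1 -> Theta2 u2 -> feasible P T Z G Y u1 u2 ->
  Jlambda P T Z G Y lam i u1 u2 = J P T Z G Y i u1 u2.
Proof.
move=> [Pc [_ _ [_ mA _ _] _ _] _ _] [_ _ adm] h1 h2 feas12.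
have [_ intfg _ _] := adm _ _ h1 h2.
(* Symmetry gives the role of [X] to the payoff without multiplier, whose measurability is known. *)
apply/esym/expectation_from_ae_eq => //; first exact: mA.
  exact: measurable_payoff.
by apply: filterS feas12 => w /= ->; rewrite mulr0 addr0.
Qed.

(** There are finitely many regimes, so one null set serves them all, and off it the random regime
    at time [T] can be substituted. *)
Lemma feasible_of_regimes u1 u2 :
  0 <= T -> markov_chain P Z ->
  (forall i, {ae P, forall w, constraint_fun G (Y u1 u2 T w) (basis_vec i) = 0}) ->
  feasible P T Z G Y u1 u2.
Proof.
move=> T0 [reg _ _ _] /filter_forall; apply: filterS => w /= M0.
by have [i _ <-] := reg T w T0.
Qed.

End multiplier.

Theorem theorem3p1 (R : realType) (d : measure_display)
    (Omega : measurableType d) (P : probability Omega R)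
    (n m L D : nat) (T : R) (Z : noise R Omega m L D)
    (G : game_data R n m L D) (y : 'rV[R]_n)
    (Theta1 Theta2 : set (process R Omega n))
    (Y : process R Omega n -> process R Omega n -> process R Omega n)
    (Delta1 : set (Omega -> R))
    (phi : (Omega -> R) -> 'I_D -> R)
    (u1s u2s : (Omega -> R) -> process R Omega n)
    (lam0 : Omega -> R) :
  0 < T ->
  noise_spec P T Z ->
  game_spec T G ->
  admissible P T Z G y Theta1 Theta2 Y ->
  Delta1 `<=` Delta P T Z ->
  (forall lam, Delta1 lam ->
     solves_unconstrained Theta1 Theta2 (Jlambda P T Z G Y lam)
       (phi lam) (u1s lam) (u2s lam)) ->
  Delta1 lam0 ->
  (forall i : 'I_D, {ae P, forall w,
     constraint_fun G (Y (u1s lam0) (u2s lam0) T w) (basis_vec i) = 0}) ->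
  solves_constrained Theta1 Theta2 (feasible P T Z G Y) (J P T Z G Y)
    (phi lam0) (u1s lam0) (u2s lam0) /\
  (forall i : 'I_D,
     (coupled_sup_inf Theta1 Theta2 (feasible P T Z G Y) (J P T Z G Y i) <=
      coupled_inf_sup Theta1 Theta2 (feasible P T Z G Y) (J P T Z G Y i))%E ->
     (phi lam0 i)%:E =
       coupled_sup_inf Theta1 Theta2 (feasible P T Z G Y) (J P T Z G Y i) /\
     (phi lam0 i)%:E =
       coupled_inf_sup Theta1 Theta2 (feasible P T Z G Y) (J P T Z G Y i)).
Proof.
move=> T0 noiseP _ admP _ solP lam0D M0.
have JlE i u1 u2 := @Jlambda_feasible _ _ _ _ _ _ _ P T Z G _ _ _ Y lam0 i u1 u2
  noiseP admP.
have feas0 : feasible P T Z G Y (u1s lam0) (u2s lam0).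
  apply: feasible_of_regimes (ltW T0) _ M0.
  by have [_ []] := noiseP.
split; first exact: solves_constrained_of_agree JlE (solP _ lam0D) feas0.
by move=> i; exact: coupled_value_of_agree JlE (solP _ lam0D) feas0 i.
Qed.
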